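(* Let $\mathcal U_{3,\mathbb R}$ be the set of all polynomials $p(z)=z+a_2z^2+a_3z^3$ with $a_2,a_3\in\mathbb R$ that are univalent in $\mathbb D$. The Koebe radius $\rho(\mathcal U_{3,\mathbb R})$ satisfies $$\rho(\mathcal U_{3,\mathbb R})=m(p_3)=\frac{1}{4\cos^2(\pi/5)}=\frac{3-\sqrt5}{2},$$ where $p_3(z)=z+\frac{2}{\sqrt5}z^2+\frac12\left(1-\frac1{\sqrt5}\right)z^3$.
   Context: $\mathbb D=\{z\in\mathbb C:|z|<1\}$ and $\mathbb T=\{z\in\mathbb C:|z|=1\}$. A function is univalent in $\mathbb D$ if it is injective on $\mathbb D$. The coefficients $a_2,a_3$ are allowed to vanish. For a polynomial $p$, $m(p):=\min\{|p(\zeta)|:\zeta\in\mathbb T\}$. Let $S$ be the set of univalent analytic functions $f$ on $\mathbb D$ with $f(0)=0$ and $f'(0)=1$. For a set $X\subset S$, the Koebe radius $\rho(X)$ is the supremum of those $r>0$ for which $\bigcap_{f\in X}f(\mathbb D)$ contains the disk $\{w\in\mathbb C:|w|<r\}$. *)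

(* Defs.v *)
From mathcomp Require Import all_boot all_order all_algebra.
From mathcomp Require Import complex.
From mathcomp Require Import all_classical all_reals all_analysis.

Set Implicit Arguments.
Unset Strict Implicit.
Unset Printing Implicit Defensive.

Import Order.TTheory GRing.Theory Num.Theory.
Import numFieldNormedType.Exports.

Local Open Scope classical_set_scope.
Local Open Scope ring_scope.
Local Open Scope complex_scope.

(* On R[i] the norm `|z| and the order are R[i]-valued: x <= y there means that
   y - x is a nonnegative real, so `|z| < r%:C is the usual |z| < r. *)

Definition disk (R : realType) (r : R) : set R[i] := [set z | `|z| < r%:C].

Definition unit_circle (R : realType) : set R[i] := [set z | `|z| = 1].

Definition univalent (R : realType) (f : R[i] -> R[i]) : Prop :=
  set_inj (disk 1) f.

(* Functions on the unit disk are represented by total functions, of which only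
   the values on [disk 1] matter; analytic means complex differentiable at every
   point of the disk (the increments range over R[i]^o, so [is_derive _ 1] is
   the complex derivative). *)
Definition classS (R : realType) : set (R[i] -> R[i]) :=
  [set f | [/\ forall z, disk 1 z -> derivable (f : R[i]^o -> R[i]^o) z 1,
    univalent f, f 0 = 0 & is_derive (0 : R[i]^o) (1 : R[i]^o) f 1]].

(* The supremum is taken in the extended reals, so that no convention for
   suprema of unbounded sets intervenes. *)
Definition koebe_radius (R : realType) (X : set (R[i] -> R[i])) : \bar R :=
  ereal_sup [set r%:E | r in [set r : R |
    0 < r /\ disk r `<=` \bigcap_(f in X) (f @` disk 1)]].

(* An infimum, which is attained: see [min_modulusP]. *)
Definition min_modulus (R : realType) (p : {poly R[i]}) : R :=
  inf [set complex.Re `|p.[z]| | z in @unit_circle R].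

Definition real_cubic (R : realType) (a2 a3 : R) : {poly R[i]} :=
  'X + a2%:C *: 'X^2 + a3%:C *: 'X^3.

Definition U3R (R : realType) : set {poly R[i]} :=
  [set p | univalent (horner p) /\ exists a2 a3 : R, p = real_cubic a2 a3].

Definition p3 (R : realType) : {poly R[i]} :=
  real_cubic (2 / Num.sqrt 5) (1 / 2 * (1 - 1 / Num.sqrt 5)).

Lemma horner_real_cubic (R : realType) (a2 a3 : R) (z : R[i]) :
  (real_cubic a2 a3).[z] = z + a2%:C * z ^+ 2 + a3%:C * z ^+ 3.
Proof. by rewrite /real_cubic !hornerE. Qed.

Lemma is_derive_cubic (K : numFieldType) (a b z : K) :
  is_derive (z : K^o) (1 : K^o) ((fun x => x + a * x ^+ 2 + b * x ^+ 3) : K^o -> K^o)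
    (1 + a * (2 * z) + b * (3 * z ^+ 2)).
Proof.
have hid : is_derive (z : K^o) (1 : K^o) (id : K^o -> K^o) 1 by exact: is_derive_id.
have h2 := is_deriveX 2 hid.
have h3 := is_deriveX 3 hid.
have := is_deriveD (is_deriveD hid (is_deriveZ a h2)) (is_deriveZ b h3).
rewrite /GRing.scale /= !mulr1.
set f := (X in is_derive _ _ X _); set g := (X in _ -> is_derive _ _ X _).
suff -> : f = g by [].
by apply/funext => x; rewrite /f /g !fctE.
Qed.

Lemma is_derive_real_cubic (R : realType) (a2 a3 : R) (z : R[i]) :
  is_derive (z : R[i]^o) (1 : R[i]^o)
    (horner (real_cubic a2 a3) : R[i]^o -> R[i]^o)
    (1 + a2%:C * (2 * z) + a3%:C * (3 * z ^+ 2)).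
Proof.
suff -> : horner (real_cubic a2 a3) = fun x => x + a2%:C * x ^+ 2 + a3%:C * x ^+ 3.
  exact: is_derive_cubic.
by apply/funext => x; exact: horner_real_cubic.
Qed.

Lemma U3R_classS (R : realType) : horner @` @U3R R `<=` @classS R.
Proof.
move=> _ [p [pu [a2 [a3 pE]]] <-]; subst p; split => //.
- by move=> z _; have [] := is_derive_real_cubic a2 a3 z.
- by rewrite horner_real_cubic !expr0n /= !mulr0 !addr0.
- by have := is_derive_real_cubic a2 a3 0; rewrite expr0n /= !mulr0 !addr0.
Qed.

Lemma min_modulusP (R : realType) (p : {poly R[i]}) :
  (exists2 z, unit_circle z & `|p.[z]| = (min_modulus p)%:C) /\
  (forall z, unit_circle z -> (min_modulus p)%:C <= `|p.[z]|).
Proof.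
pose e (t : R) : R[i] := cos t +i* sin t.
have cRI : forall q : {poly R[i]},
    continuous (fun t => complex.Re q.[e t]) /\
    continuous (fun t => complex.Im q.[e t]).
  elim/poly_ind => [|q c [cR cI]].
    by split=> t; under eq_fun do rewrite horner0 /=; exact: cst_continuous.
  split=> t.
    under eq_fun => x.
      rewrite hornerD hornerM hornerX hornerC.
      have -> : complex.Re (q.[e x] * e x + c) =
          complex.Re q.[e x] * cos x - complex.Im q.[e x] * sin x + complex.Re c.
        by rewrite /e; case: q.[_] => ? ?; case: c => ? ?.
      over.
    apply: cvgD; last exact: cvg_cst.
    by apply: cvgB; apply: cvgM; 
      [exact: cR | exact: continuous_cos | exact: cI | exact: continuous_sin].
  under eq_fun => x.
    rewrite hornerD hornerM hornerX hornerC.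
    have -> : complex.Im (q.[e x] * e x + c) =
        complex.Re q.[e x] * sin x + complex.Im q.[e x] * cos x + complex.Im c.
      by rewrite /e; case: q.[_] => ? ?; case: c => ? ?.
    over.
  apply: cvgD; last exact: cvg_cst.
  by apply: cvgD; apply: cvgM; 
    [exact: cR | exact: continuous_sin | exact: cI | exact: continuous_cos].
have [cR cI] := cRI p.
pose g t : R := Num.sqrt (complex.Re p.[e t] ^+ 2 + complex.Im p.[e t] ^+ 2).
have gE t : `|p.[e t]| = (g t)%:C by rewrite normc_def.
have cg : {within `[- pi, pi], continuous g}.
  apply: continuous_subspaceT => t.
  apply: (@continuous_comp _ _ _
    (fun t => complex.Re p.[e t] ^+ 2 + complex.Im p.[e t] ^+ 2)
    (@Num.sqrt R)); last exact: sqrt_continuous.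
  by apply: cvgD; apply: cvgM; [exact: cR|exact: cR|exact: cI|exact: cI].
have pipi : - pi <= pi :> R by rewrite ge0_cp// pi_ge0.
have [t0 _ t0min] := EVT_min pipi cg.
have ecirc t : unit_circle (e t).
  by rewrite /unit_circle /= normc_def /= cos2Dsin2 sqrtr1.
have circe z : unit_circle z -> exists2 t, t \in `[- pi, pi] & z = e t.
  case: z => x y; rewrite /unit_circle /= normc_def /= => -[] xy1.
  have {}xy1 : x ^+ 2 + y ^+ 2 = 1.
    by rewrite -[LHS]sqr_sqrtr ?xy1 ?expr1n// addr_ge0 ?sqr_ge0.
  have x1 : -1 <= x <= 1.
    by rewrite -ler_norml -(@expr_le1 _ 2)// real_normK ?num_real// -xy1 lerDl sqr_ge0.
  have y2 : Num.sqrt (1 - x ^+ 2) = `|y|.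
    by rewrite -xy1 addrAC subrr add0r sqrtr_sqr.
  have [y0|y0] := leP 0 y.
    exists (acos x).
      by rewrite in_itv /= acos_lepi// (le_trans _ (acos_ge0 x1))// oppr_le0 pi_ge0.
    by rewrite /e acosK// sin_acos// y2 ger0_norm.
  exists (- acos x).
    by rewrite in_itv /= lerN2 acos_lepi//= (le_trans _ (pi_ge0 R))// oppr_le0 acos_ge0.
  by rewrite /e cosN sinN acosK// sin_acos// y2 ltr0_norm// opprK.
have gmin z : unit_circle z -> (g t0)%:C <= `|p.[z]|.
  by move=> /circe[t /t0min gt ->]; rewrite gE lecR.
suff -> : min_modulus p = g t0.
  by split=> //; exists (e t0).
have lbg : lbound [set complex.Re `|p.[z]| | z in @unit_circle R] (g t0).
  by move=> _ [z /gmin + <-]; rewrite {1}normc_def lecR normc_def.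
apply/eqP; rewrite eq_le; apply/andP; split.
  apply: ge_inf; first by exists (g t0).
  by exists (e t0) => //; rewrite gE.
apply: lb_le_inf => //.
by exists (g t0), (e t0) => //; rewrite gE.
Qed.

(* Main.v *)
Require Import Defs.
From mathcomp Require Import all_boot all_order all_algebra.
From mathcomp Require Import complex polyrcf.
From mathcomp Require Import all_classical all_reals all_analysis.
From mathcomp Require Import ring lra.

Import Order.TTheory GRing.Theory Num.Theory.
Import numFieldNormedType.Exports.
Local Open Scope classical_set_scope.
Local Open Scope ring_scope.

(* A polynomial fixing 0 whose modulus is at least m on the unit circle covers
   the disk of radius m, by a continuity argument along the segment [0, w]. For
   a univalent z + a z^2 + b z^3, injectivity on mirror pairs z, z^* gives
   1 - b + 2 a u + 4 b u^2 >= 0 for -1 < u < 1, which together with b <= 3/8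
   forces the modulus on the circle to be at least m = (3 - sqrt 5) / 2.
   The bound is sharp because p_3(-1) = -m is not taken by p_3 inside the disk.
   Univalence of p_3: for z <> w, p_3(z) = p_3(w) amounts to
   (z + w + k)^2 = z w - 1 with k = (1 + sqrt 5) / 2 the golden ratio, which
   contradicts the Schur-Cohn inequality |s - s^* q| < 1 - |q|^2 for the sum s
   and the product q of two points of the disk. *)

(** * Real inequalities behind the univalence of p_3 *)

(* With rho = z + w + k, N = |rho|^2, y = 2 Re rho / N and
   S = (1 - |z w|^2) / N^2, this is the negation of the Schur-Cohn inequality
   for a pair satisfying rho^2 = z w - 1. *)
Lemma schur_cohn_ineq (F : realFieldType) (k y S : F) :
  0 < k -> k ^+ 2 = k + 1 -> 0 <= S ->
  4 * S ^+ 2 <= (k * S + (y + k)) ^+ 2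
     + (y ^+ 2 + 2 + 2 * S) * (y * (y + k) + S) ^+ 2.
Proof.
move=> k0 kk S0; set g := y + k.
have k1 : 8 / 5 < k by nra.
have k2 : k < 13 / 8 by nra.
have yE : y = g - k by rewrite /g; ring.
have E0 : 0 <= y ^+ 2 + 2 + 2 * S by nra.
have sq0 : 0 <= (y * g + S) ^+ 2 by apply: sqr_ge0.
(* For large [g] the first square suffices: [k * S + g] is then at least [2 * S]. *)
have [gS|gS] := leP ((2 - k) * S) g.
  have : 0 <= (g - (2 - k) * S) * (g + (2 + k) * S).
    apply: mulr_ge0; nra.
  have := mulr_ge0 E0 sq0; nra.
(* The share [3 - k] of the factor [y ^+ 2 + 2 + 2 * S] is split off because k^2 - 4 + (3 - k) = 0
   cancels the S^2 terms. Only the last summand can then be negative. *)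
have key : (k * S + g) ^+ 2 + (y ^+ 2 + 2 + 2 * S) * (y * g + S) ^+ 2 - 4 * S ^+ 2
   = (y ^+ 2 + (k - 1) + 2 * S) * (y * g + S) ^+ 2
     + g ^+ 2 * (1 + (3 - k) * y ^+ 2) + 2 * g * S * ((3 - k) * y + k).
  have -> : (k * S + g) ^+ 2 = (k + 1) * S ^+ 2 + 2 * k * S * g + g ^+ 2 by rewrite -kk; ring.
  ring.
rewrite -subr_ge0 key.
have E1 : 0 <= y ^+ 2 + (k - 1) + 2 * S by nra.
have T1 := mulr_ge0 E1 sq0.
have T2 : 0 <= g ^+ 2 * (1 + (3 - k) * y ^+ 2).
  by apply: mulr_ge0; [exact: sqr_ge0|nra].
have [gc|gc] := leP 0 (g * ((3 - k) * y + k)).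
  have : 0 <= 2 * S * (g * ((3 - k) * y + k)) by apply: mulr_ge0 => //; apply: mulr_ge0.
  have -> : 2 * S * (g * ((3 - k) * y + k)) = 2 * g * S * ((3 - k) * y + k) by ring.
  lra.
have [g0|g0] := leP g 0.
  have hk : (3 - k) * y + k <= 0.
    have : 0 <= (3 - k) * - g by apply: mulr_ge0; lra.
    rewrite yE; nra.
  by move: gc; rewrite ltNge -mulrNN mulr_ge0// oppr_ge0.
have yc : (3 - k) * y + k < 0 by rewrite -(pmulr_rlt0 _ g0).
have yk : - k < y by rewrite yE; lra.
(* Here y < - k / (3 - k), and [8 / 7] is the value of k / (3 - k) at the lower bound [8 / 5] for
   [k]. *)
have y1 : y < - (8 / 7).
  rewrite ltNge; apply/negP => y1.
  have : 0 <= (3 - k) * (y + 8 / 7) by apply: mulr_ge0; lra.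
  lra.
have y2 : 64 / 49 <= y ^+ 2.
  have : 0 <= (- (8 / 7) - y) * (8 / 7 - y) by apply: mulr_ge0; lra.
  by rewrite (_ : _ * _ = y ^+ 2 - 64 / 49) ?subr_ge0//; field.
have gS0 : 0 <= g * S by rewrite mulr_ge0// ltW.
have kg : k * g <= 5 / 8 * S.
  have : k * g <= k * ((2 - k) * S) by rewrite ler_wpM2l// ltW.
  have -> : k * ((2 - k) * S) = (k - 1) * S.
    by rewrite (_ : k - 1 = 2 * k - k ^+ 2); [ring|rewrite kk; ring].
  have : 0 <= (13 / 8 - k) * S by apply: mulr_ge0; lra.
  lra.
have S1 : 3 / 8 * S <= y * g + S.
  have : 0 <= (y + k) * g by rewrite mulr_ge0// ltW//; lra.
  lra.
have S2 : 9 / 64 * S ^+ 2 <= (y * g + S) ^+ 2.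
  have : (3 / 8 * S) ^+ 2 <= (y * g + S) ^+ 2 by rewrite lerXn2r// nnegrE; lra.
  by rewrite exprMn (_ : (3 / 8) ^+ 2 = 9 / 64)//; field.
have T3 : 19 / 10 * (9 / 64 * S ^+ 2) <= (y ^+ 2 + (k - 1) + 2 * S) * (y * g + S) ^+ 2.
  have := sqr_ge0 S => ?; apply: ler_pM => //; lra.
have T4 : g ^+ 2 * 2 <= g ^+ 2 * (1 + (3 - k) * y ^+ 2).
  rewrite ler_wpM2l ?sqr_ge0//.
  have : 0 <= (13 / 8 - k) * y ^+ 2 by rewrite mulr_ge0 ?sqr_ge0//; lra.
  lra.
have T5 : - (13 / 10) * (g * S) <= 2 * g * S * ((3 - k) * y + k).
  have h : - (13 / 20) <= (3 - k) * y + k.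
    have : 0 <= (3 - k) * (y + k) by apply: mulr_ge0; lra.
    have -> : (3 - k) * (y + k) = (3 - k) * y + 3 * k - k ^+ 2 by ring.
    lra.
  have : 0 <= (g * S) * ((3 - k) * y + k + 13 / 20) by apply: mulr_ge0; lra.
  have -> : 2 * g * S * ((3 - k) * y + k) = 2 * (g * S * ((3 - k) * y + k)) by ring.
  rewrite mulrDr mulrDr; lra.
(* Completing the square absorbs the cross term of [T5]: [169 / 800] is below the coefficient of S^2
   in [T3]. *)
have : 0 <= 2 * (g - 13 / 40 * S) ^+ 2 by rewrite mulr_ge0 ?sqr_ge0.
have -> : 2 * (g - 13 / 40 * S) ^+ 2 = g ^+ 2 * 2 - 13 / 10 * (g * S) + 169 / 800 * S ^+ 2 by field.
have := sqr_ge0 S.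
lra.
Qed.

(** The difference of the two sides factors as (1 - |z|^2) (1 - |w|^2) |1 - z conj(w)|^2, where the
    last factor appears as (1 - |z|^2) (1 - |w|^2) + |z - w|^2. *)
Lemma schur_cohn_roots_in_disk (F : realFieldType) (x1 y1 x2 y2 : F)
    (s1 := x1 + x2) (s2 := y1 + y2)
    (q1 := x1 * x2 - y1 * y2) (q2 := x1 * y2 + x2 * y1) :
  x1 ^+ 2 + y1 ^+ 2 < 1 -> x2 ^+ 2 + y2 ^+ 2 < 1 ->
  q1 ^+ 2 + q2 ^+ 2 < 1 /\
  (s1 - (s1 * q1 + s2 * q2)) ^+ 2 + (s2 - (s1 * q2 - s2 * q1)) ^+ 2
    < (1 - (q1 ^+ 2 + q2 ^+ 2)) ^+ 2.
Proof.
set n1 := _ + _; set n2 := (X in _ -> X < 1 -> _) => n1_1 n2_1.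
have n1_0 : 0 <= n1 by rewrite addr_ge0 ?sqr_ge0.
have n2_0 : 0 <= n2 by rewrite addr_ge0 ?sqr_ge0.
have -> : q1 ^+ 2 + q2 ^+ 2 = n1 * n2 by rewrite /q1 /q2 /n1 /n2; ring.
split; first by rewrite mulr_ilt1.
rewrite -subr_gt0.
have -> : (1 - n1 * n2) ^+ 2 -
   ((s1 - (s1 * q1 + s2 * q2)) ^+ 2 + (s2 - (s1 * q2 - s2 * q1)) ^+ 2) =
   (1 - n1) * (1 - n2) *
     ((1 - n1) * (1 - n2) + ((x1 - x2) ^+ 2 + (y1 - y2) ^+ 2)).
  by rewrite /s1 /s2 /q1 /q2 /n1 /n2; ring.
have h : 0 < (1 - n1) * (1 - n2) by rewrite mulr_gt0 ?subr_gt0.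
by rewrite mulr_gt0// ltr_wpDr// addr_ge0 ?sqr_ge0.
Qed.

(** With rho = z + w + k = al + i be, the two equations say rho^2 = z w - 1. Scaled by |rho|^8 / 4,
    the real inequality in [y] and [S] is the reverse of Schur-Cohn. *)
Lemma golden_cone_avoids_bidisk (F : realFieldType) (k x1 y1 x2 y2 : F)
    (al := x1 + x2 + k) (be := y1 + y2) :
  0 < k -> k ^+ 2 = k + 1 ->
  x1 ^+ 2 + y1 ^+ 2 < 1 -> x2 ^+ 2 + y2 ^+ 2 < 1 ->
  al ^+ 2 - be ^+ 2 = x1 * x2 - y1 * y2 - 1 ->
  2 * (al * be) = x1 * y2 + x2 * y1 -> False.
Proof.
move=> k0 kk n1 n2 re im.
have [] := @schur_cohn_roots_in_disk _ _ _ _ _ n1 n2.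
rewrite -im (_ : x1 * x2 - y1 * y2 = al ^+ 2 - be ^+ 2 + 1); last by rewrite re; ring.
rewrite -/be (_ : x1 + x2 = al - k); last by rewrite /al; ring.
move: al be {re im n1 n2} => al be qlt1.
pose N := al ^+ 2 + be ^+ 2.
pose S := (2 * be ^+ 2 - 2 * al ^+ 2 - N ^+ 2) / N ^+ 2.
pose y := 2 * al / N.
have qE : 1 - ((al ^+ 2 - be ^+ 2 + 1) ^+ 2 + (2 * (al * be)) ^+ 2)
    = 2 * be ^+ 2 - 2 * al ^+ 2 - N ^+ 2 by rewrite /N; ring.
(* If rho vanished, z w would be 1, outside the disk. *)
have N0 : 0 < N.
  rewrite lt_neqAle addr_ge0 ?sqr_ge0// andbT; apply/eqP => N0.
  by move: qE; rewrite -N0; nra.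
have S0 : 0 <= S by rewrite divr_ge0 ?sqr_ge0// -qE subr_ge0 ltW.
rewrite qE => /lt_geF /negP; apply.
have := @schur_cohn_ineq _ k y S k0 kk S0.
rewrite -(ler_pM2l (_ : 0 < N ^+ 4 / 4)) ?divr_gt0 ?exprn_gt0//.
have Nn : al ^+ 2 + be ^+ 2 != 0 by rewrite gt_eqF.
rewrite -subr_ge0 -[X in _ -> is_true X]subr_ge0; congr (0 <= _).
by rewrite /S /y /N; field.
Qed.

(** * Lower bound for the modulus on the unit circle *)

(** The right side is |1 + a z + b z^2|^2 for |z| = 1 and x = Re z, and [m] is the smaller root of
    X^2 - 3 X + 1. The minimum over [x] is at -1 or at the vertex; well-chosen values of [u] control
    [a]. *)
Lemma cubic_modulus_bound_nonneg (F : realFieldType) (m a b x : F) :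
  0 < m -> m <= 3/2 -> m ^+ 2 = 3 * m - 1 -> 0 <= a ->
  b <= 3 / 8 ->
  (forall u, -1 < u < 1 -> 0 <= 1 - b + 2 * a * u + 4 * b * u ^+ 2) ->
  -1 <= x <= 1 ->
  m ^+ 2 <= 1 + a ^+ 2 + b ^+ 2 - 2 * b + 2 * a * (1 + b) * x + 4 * b * x ^+ 2.
Proof.
move=> m0 m32 mm a0 bub hu /andP[x1 x2].
have m2 : m < 191 / 500.
  rewrite ltNge; apply/negP => h.
  have : 0 <= (m - 191 / 500) * (3 - 191 / 500 - m) by apply: mulr_ge0; lra.
  lra.
have mm2 : m ^+ 2 < 73 / 500 by lra.
have end_bound : m <= 1 - a + b -> 0 <= 2 * a * (1 + b) + 4 * b * (x - 1) ->
    m ^+ 2 <= 1 + a ^+ 2 + b ^+ 2 - 2 * b + 2 * a * (1 + b) * x + 4 * b * x ^+ 2.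
  move=> ab h.
  have : 0 <= (1 + x) * (2 * a * (1 + b) + 4 * b * (x - 1)) by apply: mulr_ge0 => //; lra.
  have : m ^+ 2 <= (1 - a + b) ^+ 2 by rewrite lerXn2r// nnegrE; lra.
  lra.
have [ab|ab] := leP (4 * b) a.
  (* This [u] is close enough to the excluded endpoint -1 to yield [m <= 1 - a + b]. *)
  have h : 0 <= 1 - b + 2 * a * - (9 / 10) + 4 * b * (- (9 / 10)) ^+ 2.
    by apply: hu; apply/andP; split; lra.
  rewrite (_ : (- (9 / 10)) ^+ 2 = 81 / 100 :> F) in h; last by field.
  apply: end_bound; first by lra.
  have [b0|b0] := leP 0 b.
    have : 0 <= b * (1 + x) by apply: mulr_ge0; lra.
    have : 0 <= b * (a - 4 * b) by apply: mulr_ge0; lra.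
    have := sqr_ge0 b; lra.
  have : 0 <= - b * (1 - x) by apply: mulr_ge0; lra.
  have : 0 <= a * (1 + b) by apply: mulr_ge0; lra.
  lra.
have b0 : 0 < b by lra.
(* The test point is the minimiser of the quadratic in [u], which now lies in the open interval. *)
have ab2 : a ^+ 2 <= 4 * b * (1 - b).
  have : 0 <= 1 - b + 2 * a * - (a / (4 * b)) + 4 * b * (- (a / (4 * b))) ^+ 2.
    apply: hu; rewrite ltrN2 ltr_pdivrMr ?mul1r ?ab/=; last by lra.
    by rewrite (le_lt_trans (y := 0)) ?ltr01// oppr_le0 divr_ge0//; lra.
  rewrite -(pmulr_rge0 _ (_ : 0 < 4 * b)); last by lra.
  suff -> : 4 * b * (1 - b + 2 * a * - (a / (4 * b)) + 4 * b * (- (a / (4 * b))) ^+ 2)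
    = 4 * b * (1 - b) - a ^+ 2 by rewrite subr_ge0.
  by field; rewrite gt_eqF.
have [v|v] := leP (4 * b) (a * (1 + b)).
  apply: end_bound.
    suff : a <= 1 + b - m by lra.
    rewrite -(@ler_pXn2r _ 2)// ?nnegrE; [|lra..].
    apply: le_trans ab2 _; rewrite -subr_ge0.
    (* The extremal case: the square vanishes at b = (1 + m) / 5, which for m = (3 - sqrt 5) / 2 is
       the z^3 coefficient of p_3. *)
    have -> : (1 + b - m) ^+ 2 - 4 * b * (1 - b) = 5 * (b - (1 + m) / 5) ^+ 2.
      have -> : (1 + b - m) ^+ 2 = (1 + b) ^+ 2 - 2 * (1 + b) * m + m ^+ 2 by ring.
      have -> : 5 * (b - (1 + m) / 5) ^+ 2 = 5 * b ^+ 2 - 2 * b * (1 + m) + (1 + 2 * m + m ^+ 2) / 5 by field.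
      by rewrite mm; field.
    by rewrite mulr_ge0 ?sqr_ge0.
  have : 0 <= b * (1 + x) by apply: mulr_ge0; lra.
  lra.
(* the minimum over [x] is at the vertex, where the value is [(1 - b)^2 (1 - a^2 / 4b)] *)
rewrite -(ler_pM2l (_ : 0 < 4 * b)); last by lra.
have -> : 4 * b * (1 + a ^+ 2 + b ^+ 2 - 2 * b + 2 * a * (1 + b) * x + 4 * b * x ^+ 2)
  = (4 * b * x + a * (1 + b)) ^+ 2 + (1 - b) ^+ 2 * (4 * b - a ^+ 2) by ring.
suff h : 4 * b * m ^+ 2 <= (1 - b) ^+ 2 * (4 * b - a ^+ 2).
  by apply: le_trans h _; rewrite lerDr sqr_ge0.
have b1 : 0 <= (1 - b) ^+ 2 := sqr_ge0 _.
have [b29|b29] := leP (29 / 100) b.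
  have bb : 73 / 500 <= b * (1 - b) ^+ 2.
    (* The root [267 / 200] makes the three roots sum to 2, so the product agrees with
       [b * (1 - b) ^+ 2] up to an affine term. *)
    have : 0 <= (b - 29 / 100) * (3 / 8 - b) * (267 / 200 - b).
      by apply: mulr_ge0; [apply: mulr_ge0|]; lra.
    lra.
  have : (1 - b) ^+ 2 * (4 * b ^+ 2) <= (1 - b) ^+ 2 * (4 * b - a ^+ 2).
    by rewrite ler_wpM2l//; lra.
  have : 0 <= 4 * b * (b * (1 - b) ^+ 2 - m ^+ 2) by rewrite mulr_ge0; lra.
  lra.
(* For small [b] the vertex condition bounds [a] better than [ab2]. As (1 + b)^2 - 4 b = (1 - b)^2,
   the claim reduces to (1 + b) m <= (1 - b)^2. *)
have va : a ^+ 2 * (1 + b) ^+ 2 <= (4 * b) ^+ 2.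
  rewrite -exprMn; apply: lerXn2r; rewrite ?nnegrE; [|lra|exact: ltW].
  by apply: mulr_ge0; lra.
have c0 : 0 < (1 + b) ^+ 2 by rewrite exprn_gt0//; lra.
rewrite -(ler_pM2l c0).
apply: (@le_trans _ _ (4 * b * (1 - b) ^+ 4)).
  have -> : (1 + b) ^+ 2 * (4 * b * m ^+ 2) = 4 * b * ((1 + b) * m) ^+ 2 by ring.
  rewrite ler_wpM2l//; first by lra.
  rewrite (exprM (1 - b) 2 2); apply: lerXn2r; rewrite ?nnegrE ?sqr_ge0//.
    by apply: mulr_ge0; lra.
  have : 0 <= (1 + b) * (191 / 500 - m) by apply: mulr_ge0; lra.
  have : 0 <= (29 / 100 - b) * (2 - b) by apply: mulr_ge0; lra.
  lra.
have -> : (1 + b) ^+ 2 * ((1 - b) ^+ 2 * (4 * b - a ^+ 2)) =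
  (1 - b) ^+ 2 * ((1 + b) ^+ 2 * (4 * b) - a ^+ 2 * (1 + b) ^+ 2) by ring.
have -> : 4 * b * (1 - b) ^+ 4 = (1 - b) ^+ 2 * ((1 + b) ^+ 2 * (4 * b) - (4 * b) ^+ 2) by ring.
by rewrite ler_wpM2l// lerD2l lerN2.
Qed.

(** Replacing z by -z changes the signs of [a] and [x], so [a] may be taken nonnegative. *)
Lemma cubic_modulus_bound (F : realFieldType) (m a b x : F) :
  0 < m -> m <= 3/2 -> m ^+ 2 = 3 * m - 1 ->
  b <= 3 / 8 ->
  (forall u, -1 < u < 1 -> 0 <= 1 - b + 2 * a * u + 4 * b * u ^+ 2) ->
  -1 <= x <= 1 ->
  m ^+ 2 <= 1 + a ^+ 2 + b ^+ 2 - 2 * b + 2 * a * (1 + b) * x + 4 * b * x ^+ 2.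
Proof.
move=> m0 m1 mm bub hu hx.
have [a0|a0] := leP 0 a; first exact: cubic_modulus_bound_nonneg.
have := @cubic_modulus_bound_nonneg _ m (- a) b (- x) m0 m1 mm.
rewrite !sqrrN (_ : 2 * - a * (1 + b) * - x = 2 * a * (1 + b) * x); last by ring.
apply => //; first by rewrite oppr_ge0 ltW.
- move=> u /andP[u1 u2]; have := hu (- u); rewrite sqrrN.
  rewrite (_ : 2 * a * - u = 2 * - a * u); last by ring.
  by apply; apply/andP; split; lra.
- by case/andP: hx => ? ?; apply/andP; split; lra.
Qed.

Local Open Scope complex_scope.

(** * Covering a disk by a polynomial image *)

(** |p(z) - c| is the modulus of the leading coefficient times the product of the distances from z
    to the roots of p - c, so some distance is small. The bound [d] is uniform in [z] and [c]. *)
Lemma root_near_approx_root (F : numClosedFieldType) (p : {poly F}) (e : F) :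
  (1 < size p)%N -> 0 < e ->
  exists2 d, 0 < d & forall z c, `|p.[z] - c| < d ->
    exists2 z', p.[z'] = c & `|z - z'| < e.
Proof.
move=> p1 e0; have pn0 : p != 0 by rewrite -size_poly_gt0 (ltn_trans _ p1).
exists (`|lead_coef p| * e ^+ (size p).-1).
  by rewrite mulr_gt0 ?exprn_gt0// normr_gt0 lead_coef_eq0.
move=> z c; have sc : (size (- c%:P) < size p)%N.
  by rewrite size_polyN (leq_ltn_trans (size_polyC_leq1 _)).
have [r rE] := closed_field_poly_normal (p - c%:P).
have := erefl (size (p - c%:P)).
rewrite {1}rE size_scale ?size_prod_XsubC; last by rewrite lead_coefDl ?lead_coef_eq0.
rewrite size_polyDl// => sr.
have -> : p.[z] - c = (p - c%:P).[z] by rewrite !hornerE.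
have [/hasP[z' z'r zz' _]|/hasPn far] := boolP (has (fun z' => `|z - z'| < e) r).
  exists z' => //; apply/eqP; rewrite -subr_eq0.
  have -> : p.[z'] - c = (p - c%:P).[z'] by rewrite !hornerE.
  rewrite rE hornerZ; move: z'r; rewrite -root_prod_XsubC => /rootP ->.
  by rewrite mulr0.
rewrite rE hornerZ lead_coefDl// normrM ltr_pM2l ?normr_gt0 ?lead_coef_eq0//.
rewrite horner_prod normr_prod -sr /= le_gtF//.
rewrite -(count_predT r) -iter_mulr_1 -big_const_seq big_seq [in X in _ <= X]big_seq.
apply: ler_prod => z' z'r.
rewrite (ltW e0)/= !hornerE real_leNgt ?normr_real ?gtr0_real//.
exact: far.
Qed.

(** If the finitely many roots of p - c all had modulus above 1, they would have modulus at least 1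
    + e for some e > 0, out of reach of approximate roots in the disk. *)
Lemma small_root_of_approx_small_roots (R : realType) (p : {poly R[i]}) (c : R[i]) :
  (1 < size p)%N ->
  (forall d : R[i], 0 < d -> exists2 z, `|z| < 1 & `|p.[z] - c| < d) ->
  exists2 z, `|z| <= 1 & p.[z] = c.
Proof.
move=> p1 happ.
have sc : (size (- c%:P) < size p)%N.
  by rewrite size_polyN (leq_ltn_trans (size_polyC_leq1 _)).
have pc0 : p - c%:P != 0 by rewrite -size_poly_gt0 size_polyDl// (ltn_trans _ p1).
have [r rE] := closed_field_poly_normal (p - c%:P).
have memr z : (z \in r) = (p.[z] == c).
  rewrite -root_prod_XsubC; have := congr1 (root ^~ z) rE.
  by rewrite /= rootZ ?lead_coef_eq0// => <-; rewrite rootE !hornerE subr_eq0.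
have [/hasP[z zr z1]|/hasPn far] := boolP (has (fun z => `|z| <= 1) r).
  by exists z => //; apply/eqP; rewrite -memr.
have [e e0 he] : exists2 e : R[i], 0 < e & forall z, z \in r -> 1 + e <= `|z|.
  elim: r far {rE memr} => [|z r IH] far; first by exists 1.
  have [z' z'r|e e0 he] := IH; first by apply: far; rewrite inE z'r orbT.
  have z0 : 0 < `|z| - 1.
    by rewrite subr_gt0 real_ltNge ?normr_real ?real1 ?far// mem_head.
  exists (Num.min e (`|z| - 1)); first by rewrite /Order.min; case: ifP.
  have cmp : e >=< `|z| - 1 by rewrite real_comparable// gtr0_real.
  move=> z'; rewrite inE => /orP[/eqP->|/he].
    by rewrite addrC -lerBrDr comparable_ge_min// lexx orbT.
  by apply: le_trans; rewrite lerD2l comparable_ge_min// lexx.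
have [d d0 hd] := root_near_approx_root _ p e p1 e0.
have [z z1 /hd[z' /eqP]] := happ d d0.
rewrite -memr => /he z'1 zz'.
suff : `|z'| < 1 + e by move=> h; have := lt_le_trans h z'1; rewrite ltxx.
by rewrite (le_lt_trans (_ : _ <= `|z| + `|z - z'|)) ?ltrD// -{1}(subKr z z') ler_normB.
Qed.

Lemma norm_real_complex (R : rcfType) (x : R) : `|x%:C| = `|x|%:C.
Proof. by rewrite normc_def /= expr0n addr0 sqrtr_sqr. Qed.

Lemma disk_subset_image (R : realType) (p : {poly R[i]}) (m : R) :
  p.[0] = 0 -> (1 < size p)%N ->
  (forall z, unit_circle z -> m%:C <= `|p.[z]|) ->
  disk m `<=` (horner p) @` disk 1.
Proof.
move=> p0 p1 hm w /= wm.
pose T := [set t : R | 0 <= t <= 1 /\ exists2 z, `|z| < 1 & p.[z] = t%:C * w].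
have T0 : T 0.
  by split; rewrite ?lexx ?ler01//; exists 0; rewrite ?normr0 ?p0 ?mul0r.
have Tub : ubound T 1 by move=> t [/andP[]].
have hsT : has_sup T by split; [exists 0|exists 1].
set s := sup T.
have s0 : 0 <= s by apply: (ub_le_sup (ex_intro _ 1 Tub)).
have s1 : s <= 1 by apply: ge_sup => //; exists 0.
have normw : `|w| = (complex.Re `|w|)%:C by rewrite normc_def.
have w0 : 0 <= complex.Re `|w| by rewrite normc_def sqrtr_ge0.
(* both closedness and openness of [T] come from [root_near_approx_root] *)
have close d : 0 < d -> exists2 e : R, 0 < e &
    forall t t' : R, `|t - t'| < e -> `|t%:C * w - t'%:C * w| < d.
  move=> d0; have dE : d = (complex.Re d)%:C.
    by move: d0; case: d => dr di; rewrite ltcE /= => /andP[/eqP -> _].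
  have {}d0 : 0 < complex.Re d by move: d0; rewrite ltcE => /andP[].
  exists (complex.Re d / (complex.Re `|w| + 1)); first by rewrite divr_gt0// ltr_wpDl.
  move=> t t'; rewrite ltr_pdivlMr ?ltr_wpDl// => h.
  rewrite -mulrBl -rmorphB normrM norm_real_complex normw dE.
  rewrite -rmorphM ltcR; apply: le_lt_trans h.
  by rewrite ler_wpM2l// lerDl.
have [z z1 zs] : exists2 z, `|z| <= 1 & p.[z] = s%:C * w.
  apply: small_root_of_approx_small_roots => // d /close[e e0 he].
  have [t [t01 [z z1 zt]] st] := sup_adherent e0 hsT.
  exists z => //; rewrite zt; apply: he.
  have ts : t <= s by apply: (ub_le_sup (ex_intro _ 1 Tub)); split => //; exists z.
  by rewrite -/s in st; rewrite ltr_norml; apply/andP; split; lra.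
(* On the circle the modulus of p is at least [m], whereas |s w| <= |w| < m. *)
have {z1}z1 : `|z| < 1.
  rewrite lt_neqAle z1 andbT; apply/eqP => zu; have := hm z zu.
  have -> : `|p.[z]| = (s * complex.Re `|w|)%:C.
    by rewrite zs normrM {1}normw norm_real_complex ger0_norm// -rmorphM.
  move: wm; rewrite /disk /= normw ltcR lecR leNgt => wm /negP; apply.
  by apply: le_lt_trans wm; rewrite ler_piMl.
move: s1; rewrite le_eqVlt => /orP[/eqP s1|s1].
  by exists z => //; rewrite zs s1 mul1r.
exfalso.
(* If s < 1, the margin 1 - |z| keeps a solution for a slightly larger [t] inside the disk, against
   the choice of [s]. *)
have e0 : 0 < 1 - `|z| by rewrite subr_gt0.
have [d d0 hd] := root_near_approx_root _ p _ p1 e0.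
have [e {}e0 he] := close d d0.
pose t := Num.min 1 (s + e / 2).
have st : s < t by rewrite lt_min s1 ltrDl divr_gt0.
have te : t <= s + e / 2 by rewrite ge_min lexx orbT.
have [z' z't zz'] : exists2 z', p.[z'] = t%:C * w & `|z - z'| < 1 - `|z|.
  by apply: hd; rewrite zs; apply: he; rewrite ltr_norml; apply/andP; split; lra.
suff : t <= s by rewrite leNgt st.
apply: (ub_le_sup (ex_intro _ 1 Tub)).
split; first by rewrite ge_min lexx andbT (le_trans s0)// ltW.
exists z' => //; rewrite ltrBrDl in zz'; apply: le_lt_trans zz'.
by rewrite -{1}(subKr z z') ler_normB.
Qed.

(** * Divided differences and coefficient conditions for univalence *)

Lemma disk1E (R : realType) (x y : R) : disk 1 (x +i* y) <-> x ^+ 2 + y ^+ 2 < 1.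
Proof.
rewrite /disk /= normc_def ltcR /= -[X in _ < X](sqrtr1 R).
by rewrite ltr_sqrt.
Qed.

Lemma unit_circleE (R : realType) (x y : R) :
  unit_circle (x +i* y) <-> x ^+ 2 + y ^+ 2 = 1.
Proof.
rewrite /unit_circle /= normc_def /=; split => [[]|->]; last by rewrite sqrtr1.
move=> /(congr1 (fun t => t ^+ 2)).
by rewrite sqr_sqrtr ?expr1n// addr_ge0 ?sqr_ge0.
Qed.

Lemma horner_real_cubicB (R : realType) (a b : R) (z w : R[i]) :
  (real_cubic a b).[z] - (real_cubic a b).[w] =
  (z - w) * (1 + a%:C * (z + w) + b%:C * (z ^+ 2 + z * w + w ^+ 2)).
Proof. by rewrite !horner_real_cubic; ring. Qed.

Lemma univalent_real_cubicP (R : realType) (a b : R) :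
  univalent (horner (real_cubic a b)) <->
  forall z w, disk 1 z -> disk 1 w -> z != w ->
    1 + a%:C * (z + w) + b%:C * (z ^+ 2 + z * w + w ^+ 2) != 0.
Proof.
split=> [inj z w z1 w1|h z w].
  apply: contraNneq => zw0; apply/eqP/inj; rewrite ?inE//.
  by apply/eqP; rewrite -subr_eq0 horner_real_cubicB zw0 mulr0.
rewrite !inE => z1 w1 /eqP; rewrite -subr_eq0 horner_real_cubicB mulf_eq0 subr_eq0.
by have [//|zw] := eqVneq z w; rewrite (negPf (h _ _ z1 w1 zw)).
Qed.

(** At a mirror pair r (u + i v), r (u - i v) with u^2 + v^2 = 1 the divided difference is the real
    number 1 + 2 a u r + b (4 u^2 - 1) r^2. It is 1 at r = 0, so a negative value at r = 1 would
    force a zero in between. *)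
Lemma univalent_real_cubic_boundary (R : realType) (a b u : R) :
  univalent (horner (real_cubic a b)) -> -1 < u < 1 ->
  0 <= 1 - b + 2 * a * u + 4 * b * u ^+ 2.
Proof.
move=> /univalent_real_cubicP inj /andP[u1 u2]; rewrite leNgt; apply/negP => neg.
pose q : {poly R} := 1 + (2 * a * u) *: 'X + (b * (4 * u ^+ 2 - 1)) *: 'X^2.
have qE r : q.[r] = 1 + 2 * a * u * r + b * (4 * u ^+ 2 - 1) * r ^+ 2.
  by rewrite /q !hornerE.
have [r] : {r | r \in `]0, 1[ & root q r}.
  by apply: poly_ivtoo; rewrite // !qE; move: neg; lra.
rewrite in_itv/= => /andP[r0 r1] /rootP; rewrite qE => qr.
have u21 : 0 < 1 - u ^+ 2.
  by rewrite (_ : 1 - _ = (1 - u) * (1 + u)); [rewrite mulr_gt0; lra|ring].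
pose v := Num.sqrt (1 - u ^+ 2).
have v2 : v ^+ 2 = 1 - u ^+ 2 by rewrite sqr_sqrtr// ltW.
have v0 : 0 < v by rewrite sqrtr_gt0.
have n1 : (r * u) ^+ 2 + (r * v) ^+ 2 < 1.
  by rewrite !exprMn v2 -mulrDr addrC subrK mulr1 expr_lt1// ltW.
have n1' : (r * u) ^+ 2 + (- (r * v)) ^+ 2 < 1 by rewrite sqrrN.
have zz' : (r * u) +i* (r * v) != (r * u) +i* - (r * v).
  rewrite eq_complex /= eqxx/= -subr_eq0 opprK -mulr2n mulrn_eq0/=.
  by rewrite mulf_neq0// gt_eqF.
have /eqP := inj _ _ (iffRL (disk1E _ _ _) n1) (iffRL (disk1E _ _ _) n1') zz'; apply.
apply/eqP; rewrite !expr2 eq_complex /=; apply/andP; split; apply/eqP; last by ring.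
rewrite -[RHS]qr; have -> : b * (4 * u ^+ 2 - 1) = b * (3 * u ^+ 2 - v ^+ 2).
  by rewrite v2; ring.
ring.
Qed.

(** The two roots have product 1 / b, of modulus below 1, so one of them lies in the disk. *)
Lemma quadratic_root_in_disk (F : numClosedFieldType) (a b : F) :
  1 < `|b| -> exists2 z, `|z| < 1 & 1 + a * z + b * z ^+ 2 = 0.
Proof.
move=> b1; have b0 : b != 0 by rewrite -normr_gt0 (lt_trans ltr01).
pose p : {poly F} := b *: 'X^2 + (a *: 'X + 1).
have pE z : p.[z] = 1 + a * z + b * z ^+ 2.
  by rewrite /p !hornerD !hornerZ hornerXn hornerX hornerC addrC [1 + _]addrC.
have sl : (size (a *: 'X + 1 : {poly F})%R < size (b *: 'X^2 : {poly F})%R)%N.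
  rewrite size_scale// size_polyXn (leq_ltn_trans (size_polyD _ _))//.
  by rewrite gtn_max size_poly1 andbT (leq_ltn_trans (size_scale_leq _ _))// size_polyX.
have sp : size p = 3%N by rewrite /p size_polyDl// size_scale// size_polyXn.
have lp : lead_coef p = b.
  by rewrite /p lead_coefDl// lead_coefZ lead_coefXn mulr1.
have [r rE] := closed_field_poly_normal p.
have sr : size r = 2%N.
  have := sp; rewrite rE size_scale ?size_prod_XsubC; first by case.
  by rewrite lp.
have zr z : z \in r -> 1 + a * z + b * z ^+ 2 = 0.
  rewrite -root_prod_XsubC -pE => /rootP h.
  by rewrite rE hornerZ h mulr0.
move: rE zr; case: r sr => [//|z [//|w [|//]]] _ rE zr.
have bzw : `|b| * (`|z| * `|w|) = 1.
  have := pE 0; rewrite rE lp hornerZ !big_cons big_nil mulr1 hornerM !hornerXsubC.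
  by rewrite expr0n/= !mulr0 !addr0 !sub0r mulrNN -!normrM => ->; rewrite normr1.
have [z1|z1] := real_ltP (normr_real z) (@real1 F).
  by exists z => //; apply: zr; rewrite mem_head.
exists w; last by apply: zr; rewrite !inE eqxx orbT.
have w0 : 0 < `|w|.
  rewrite normr_gt0; apply/eqP => w0; move: bzw.
  by rewrite w0 normr0 !mulr0 => /esym/eqP; rewrite oner_eq0.
rewrite -bzw mulrA -[X in X < _]mul1r ltr_pM2r//.
by rewrite (lt_le_trans b1)// ler_peMr.
Qed.

(* The point [z (24 + 7 i) / 25] and its mirror image [z (24 - 7 i) / 25] have
   the same image as soon as [1 + (48/25) a z + (1679/625) b z^2 = 0]. *)
Lemma univalent_real_cubic_le (R : realType) (a b : R) :
  univalent (horner (real_cubic a b)) -> b <= 3 / 8.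
Proof.
move=> /univalent_real_cubicP inj; rewrite leNgt; apply/negP => b38.
(* The triple 7, 24, 25 gives a rational point of the circle so near 1 that (48/25)^2 - 1 = 1679/625
   exceeds 8/3. *)
pose e : R[i] := (24 / 25) +i* (7 / 25).
pose e' : R[i] := (24 / 25) +i* - (7 / 25).
have eD : e + e' = (48 / 25)%:C.
  by apply/eqP; rewrite eq_complex /=; apply/andP; split; apply/eqP; field.
have eM : e * e' = 1.
  by apply/eqP; rewrite eq_complex /=; apply/andP; split; apply/eqP; field.
have ne : `|e| = 1 by apply/unit_circleE; field.
have ne' : `|e'| = 1 by apply/unit_circleE; field.
have [|z z1 zE] := @quadratic_root_in_disk _ (a * (48 / 25))%:C (b * (1679 / 625))%:C.
  by rewrite norm_real_complex ltcR ger0_norm; lra.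
have z0 : z != 0.
  by apply/eqP => z0; move/eqP: zE; rewrite z0 expr0n/= !mulr0 !addr0 oner_eq0.
have zee' : z * e != z * e'.
  by rewrite (inj_eq (mulfI z0)) eq_complex/= eqxx/=; apply/eqP; lra.
have dze : disk 1 (z * e) by rewrite /disk /= normrM ne mulr1.
have dze' : disk 1 (z * e') by rewrite /disk /= normrM ne' mulr1.
have /eqP := inj _ _ dze dze' zee'; apply.
rewrite -zE.
have -> : 1 + a%:C * (z * e + z * e') + b%:C * ((z * e) ^+ 2 + z * e * (z * e') + (z * e') ^+ 2)
  = 1 + a%:C * (e + e') * z + b%:C * ((e + e') ^+ 2 - e * e') * z ^+ 2 by ring.
rewrite eD eM -rmorphXn -rmorphB -!rmorphM /=.
by congr (1 + _ + (_)%:C * _); field.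
Qed.

(** * Univalence of p_3 *)

Lemma sqrt5_sqr (R : rcfType) : Num.sqrt 5 ^+ 2 = 5 :> R.
Proof. by rewrite sqr_sqrtr. Qed.

Lemma sqrt5_bounds (R : rcfType) : 11 / 5 < Num.sqrt (5 : R) < 9 / 4.
Proof.
have p0 : 0 < Num.sqrt (5 : R) by rewrite sqrtr_gt0.
have p2 := sqrt5_sqr R; apply/andP; split; rewrite ltNge; apply/negP => h.
  have : 0 <= (11 / 5 - Num.sqrt (5 : R)) * (11 / 5 + Num.sqrt 5).
    by apply: mulr_ge0; lra.
  lra.
have : 0 <= (Num.sqrt (5 : R) - 9 / 4) * (Num.sqrt 5 + 9 / 4).
  by apply: mulr_ge0; lra.
lra.
Qed.

Lemma p3E (R : realType) :
  p3 R = real_cubic (2 / 5 * Num.sqrt 5) ((5 - Num.sqrt 5) / 10).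
Proof.
have t0 : Num.sqrt 5 != 0 :> R by rewrite gt_eqF ?sqrtr_gt0.
have t5 : 1 / Num.sqrt 5 = Num.sqrt 5 / 5 :> R.
  by rewrite -[X in _ = _ / X]sqrt5_sqr; field.
rewrite /p3; congr real_cubic; last by rewrite t5; field.
by rewrite -[2]mulr1 -mulrA -[1 * _]/(1 / _) t5; field.
Qed.

Lemma univalent_p3 (R : realType) : univalent (horner (p3 R)).
Proof.
rewrite p3E; apply/univalent_real_cubicP => -[x1 y1] [x2 y2].
move=> /disk1E n1 /disk1E n2 _; apply/eqP.
have t2 := sqrt5_sqr R; have /andP[t_lo t_hi] := sqrt5_bounds R.
set t := Num.sqrt 5 in t2 t_lo t_hi *.
move=> /eqP; rewrite !expr2 eq_complex /= => /andP[/eqP re /eqP im].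
(* With b (k^2 + 1) = 1 and 2 b k equal to the z^2 coefficient, the divided difference is b ((s +
   k)^2 + 1 - q) for the sum s and product q. *)
pose b := (5 - t) / 10; pose k := (1 + t) / 2.
have b0 : b != 0 by rewrite gt_eqF// /b; lra.
have kk : k ^+ 2 = k + 1.
  by transitivity ((1 + 2 * t + t ^+ 2) / 4); rewrite /k; [|rewrite t2]; field.
have bk1 : b * (k ^+ 2 + 1) = 1.
  by transitivity ((25 - t ^+ 2) / 20); rewrite ?kk /b /k; [|rewrite t2]; field.
have bk2 : 2 * b * k = 2 / 5 * t.
  by transitivity ((5 + 4 * t - t ^+ 2) / 10); rewrite /b /k; [|rewrite t2]; field.
rewrite -/b in re im.
apply: (@golden_cone_avoids_bidisk _ k _ _ _ _ _ kk n1 n2).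
- by rewrite /k; lra.
- apply/eqP; rewrite -subr_eq0; apply/eqP/(mulfI b0).
  transitivity (b * (k ^+ 2 + 1) + 2 * b * k * (x1 + x2)
    + b * ((x1 + x2) ^+ 2 - (y1 + y2) ^+ 2 - (x1 * x2 - y1 * y2))); first by ring.
  by rewrite bk1 bk2 mulr0 -[RHS]re; ring.
- apply/eqP; rewrite -subr_eq0; apply/eqP/(mulfI b0).
  transitivity (2 * b * k * (y1 + y2)
    + b * (2 * (x1 + x2) * (y1 + y2) - (x1 * y2 + x2 * y1))); first by ring.
  by rewrite bk2 mulr0 -[RHS]im; ring.
Qed.

(** * Minimum modulus and the omitted value p_3(-1) *)

Lemma golden_min_modulus (R : realType) (m := (3 - Num.sqrt 5) / 2 : R) :
  [/\ 0 < m, m <= 3 / 2 & m ^+ 2 = 3 * m - 1].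
Proof.
have /andP[t_lo t_hi] := sqrt5_bounds R; split; rewrite /m; try lra.
rewrite (_ : _ ^+ 2 = (9 - 6 * Num.sqrt 5 + Num.sqrt 5 ^+ 2) / 4); last by field.
by rewrite sqrt5_sqr; field.
Qed.

Lemma univalent_real_cubic_norm_ge (R : realType) (a b : R) (z : R[i]) :
  univalent (horner (real_cubic a b)) -> unit_circle z ->
  ((3 - Num.sqrt 5) / 2)%:C <= `|(real_cubic a b).[z]|.
Proof.
move=> inj; case: z => x y /unit_circleE xy1.
have [m0 m32 mm] := golden_min_modulus R.
set m := (3 - _) / 2 in m0 m32 mm *.
rewrite horner_real_cubic normc_def lecR -[X in X <= _](ger0_norm (ltW m0)) -sqrtr_sqr.
rewrite ler_wsqrtr//.
have x1 : -1 <= x <= 1.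
  by rewrite -ler_norml -(@expr_le1 _ 2)// real_normK ?num_real// -xy1 lerDl sqr_ge0.
have hu u : -1 < u < 1 -> _ := @univalent_real_cubic_boundary R a b u inj.
have := @cubic_modulus_bound _ m a b x m0 m32 mm (univalent_real_cubic_le _ _ _ inj) hu x1.
move=> /le_trans; apply; rewrite le_eqVlt; apply/orP; left; apply/eqP.
rewrite [_ ^+ 3]exprS !expr2 /=.
have y2 : y ^+ 2 = 1 - x ^+ 2 by rewrite -xy1; ring.
(* Factoring out z, of modulus 1, leaves |1 + a z + b z^2|^2. *)
transitivity ((x ^+ 2 + y ^+ 2) * ((1 + a * x + b * (x ^+ 2 - y ^+ 2)) ^+ 2
   + (a * y + 2 * b * x * y) ^+ 2)); last by ring.
transitivity (1 + a ^+ 2 * (x ^+ 2 + y ^+ 2) + b ^+ 2 * (x ^+ 2 + y ^+ 2) ^+ 2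
   + 2 * a * x + 2 * b * (x ^+ 2 - y ^+ 2) + 2 * a * b * x * (x ^+ 2 + y ^+ 2)).
  by rewrite xy1 y2; ring.
by rewrite [X in _ = X * _]xy1 mul1r; ring.
Qed.

Lemma p3N1 (R : realType) : (p3 R).[-1] = (- ((3 - Num.sqrt 5) / 2))%:C.
Proof.
rewrite p3E horner_real_cubic.
apply/eqP; rewrite !exprS expr0 eq_complex /=; apply/andP; split; apply/eqP; by field.
Qed.

(** Cancelling z + 1 leaves a real quadratic in z with negative discriminant, whose conjugate roots
    have product greater than 1. *)
Lemma p3N1_notin_image (R : realType) (z : R[i]) :
  disk 1 z -> (p3 R).[z] != (p3 R).[-1].
Proof.
case: z => x y /disk1E n1; rewrite p3E -subr_eq0 horner_real_cubicB mulf_neq0//.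
  rewrite subr_eq0; apply/eqP => -[x1 y0]; move: n1; rewrite x1 y0.
  by rewrite oppr0 sqrrN expr1n expr0n addr0 ltxx.
have t2 := sqrt5_sqr R; have /andP[t_lo t_hi] := sqrt5_bounds R.
set t := Num.sqrt 5 in t2 t_lo t_hi *.
apply/eqP => /eqP; rewrite !expr2 eq_complex /= => /andP[/eqP re /eqP im].
set b := (5 - t) / 10.
have b0 : 0 < b by rewrite /b; lra.
have {}re : b * (x ^+ 2 - y ^+ 2) + (t - 1) / 2 * x + (3 - t) / 2 = 0.
  by rewrite -[RHS]re /b; field.
have {}im : y * (2 * b * x + (t - 1) / 2) = 0.
  by rewrite -[RHS]im /b; field.
move/eqP: im; rewrite mulf_eq0 => /orP[/eqP y0|/eqP xE].
  have : 0 <= (2 * b * x + (t - 1) / 2) ^+ 2 by exact: sqr_ge0.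
  have -> : (2 * b * x + (t - 1) / 2) ^+ 2 =
     4 * b * (b * (x ^+ 2 - y ^+ 2) + (t - 1) / 2 * x + (3 - t) / 2)
      + (1 - 2 * t + t ^+ 2) / 4 - (15 - 8 * t + t ^+ 2) / 5.
    by rewrite /b y0; field.
  by rewrite re t2; lra.
have e : b * (x ^+ 2 + y ^+ 2) = (3 - t) / 2.
  move: re; rewrite (_ : (t - 1) / 2 = - (2 * b * x)); last by lra.
  lra.
have : 0 < b * (1 - (x ^+ 2 + y ^+ 2)) by rewrite mulr_gt0// subr_gt0.
by rewrite mulrBr e /b; lra.
Qed.

Lemma min_modulus_p3 (R : realType) : min_modulus (p3 R) = (3 - Num.sqrt 5) / 2.
Proof.
have [[z z1 zE] zmin] := min_modulusP (p3 R).
have [m0 _ _] := golden_min_modulus R.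
apply/eqP; rewrite eq_le -!lecR; apply/andP; split.
  have /zmin : unit_circle (-1 : R[i]) by rewrite /unit_circle /= normrN1.
  by rewrite p3N1 norm_real_complex normrN ger0_norm// ltW.
rewrite -zE p3E; apply: univalent_real_cubic_norm_ge => //.
rewrite -p3E; exact: univalent_p3.
Qed.

(** * The Koebe radius and its trigonometric form *)

Lemma koebe_radius_U3R (R : realType) :
  koebe_radius (horner @` @U3R R) = ((3 - Num.sqrt 5) / 2)%:E.
Proof.
have [m0 _ _] := golden_min_modulus R.
apply/eqP; rewrite eq_le; apply/andP; split.
  apply: ge_ereal_sup => _ [r [r0 hr] <-]; rewrite lee_fin leNgt; apply/negP => mr.
  have : disk r (p3 R).[-1].
    by rewrite /disk /= p3N1 norm_real_complex normrN ger0_norm ?ltcR// ltW.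
  move=> /hr /(_ (horner (p3 R)))[].
    exists (p3 R) => //; split; first exact: univalent_p3.
    by eexists; eexists; reflexivity.
  by move=> z z1 /eqP; rewrite (negPf (p3N1_notin_image _ _ z1)).
apply: ereal_sup_ubound; eexists; last by reflexivity.
split=> // w wm _ [p [pinj [a [b pE]]] <-].
apply: disk_subset_image wm; rewrite pE.
- by rewrite horner_real_cubic !expr0n/= !mulr0 !addr0.
- rewrite ltnNge; apply/negP => /leq_sizeP/(_ 1%N isT)/eqP.
  by rewrite /real_cubic !coefE/= !mulr0 !addr0 oner_eq0.
- by move=> z; apply: univalent_real_cubic_norm_ge; rewrite -pE.
Qed.

Lemma cos_pi5 (R : realType) : cos (pi / 5) = (1 + Num.sqrt 5) / 4 :> R.
Proof.
set c := cos _; have pi0 := pi_gt0 R.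
have c0 : 0 < c by apply: cos_gt0_pihalf; apply/andP; split; lra.
(* [c] is a root of [cos 3x = - cos 2x], where [3x = pi - 2x] *)
have h : (c + 1) * (4 * c ^+ 2 - 2 * c - 1) = 0.
  have : cos (pi / 5 *+ 2 + pi / 5) = - cos (pi / 5 *+ 2) :> R.
    rewrite -[in RHS]cosN -cosDpi; congr cos; rewrite -mulr_natr; lra.
  move=> /eqP; rewrite -subr_eq0 opprK cosD sin_mulr2n cos_mulr2n -/c => /eqP e.
  transitivity ((c ^+ 2 *+ 2 - 1) * c - c * (1 - c ^+ 2) *+ 2 + (c ^+ 2 *+ 2 - 1)).
    by ring.
  by rewrite -(sin2cos2 (pi / 5)) -[RHS]e; ring.
have {}h : 4 * c ^+ 2 - 2 * c - 1 = 0.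
  by move/eqP: h; rewrite mulf_eq0 => /orP[/eqP|/eqP//]; lra.
(* The roots of the quadratic are (1 + sqrt 5) / 4 and (1 - sqrt 5) / 4; positivity of [c] selects
   the first. *)
have : (4 * c - 1 - Num.sqrt 5) * (4 * c - 1 + Num.sqrt 5) = 0.
  have -> : (4 * c - 1 - Num.sqrt 5) * (4 * c - 1 + Num.sqrt 5)
    = 4 * (4 * c ^+ 2 - 2 * c - 1) + 5 - Num.sqrt 5 ^+ 2 by ring.
  by rewrite h sqrt5_sqr; ring.
have /andP[t_lo _] := sqrt5_bounds R.
by move=> /eqP; rewrite mulf_eq0 => /orP[] /eqP; lra.
Qed.

Local Close Scope complex_scope.

Theorem mainTheorem2 (R : realType) :
  [/\ koebe_radius (horner @` @U3R R) = (min_modulus (p3 R))%:E,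
      min_modulus (p3 R) = 1 / (4 * cos (pi / 5) ^+ 2) &
      1 / (4 * cos (pi / 5) ^+ 2) = (3 - Num.sqrt 5) / 2 :> R].
Proof.
have cE : 1 / (4 * cos (pi / 5) ^+ 2) = (3 - Num.sqrt 5) / 2 :> R.
  have t0 : 0 < Num.sqrt (5 : R) by rewrite sqrtr_gt0.
  have n0 : 4 * ((1 + Num.sqrt 5) / 4) ^+ 2 != 0 :> R.
    by rewrite mulf_neq0// expf_neq0// gt_eqF//; lra.
  rewrite cos_pi5; apply: (mulIf n0); rewrite divfK//.
  have -> : (3 - Num.sqrt 5) / 2 * (4 * ((1 + Num.sqrt 5) / 4) ^+ 2) =
     (3 + 5 * Num.sqrt 5 + Num.sqrt 5 ^+ 2 - Num.sqrt 5 ^+ 2 * Num.sqrt 5) / 8 :> R by field.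
  by rewrite sqrt5_sqr; field.
by rewrite cE min_modulus_p3 koebe_radius_U3R.
Qed.
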